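(* Let $p$ be a prime number or zero. Let $F,K$ be integral domains with $\mathrm{char}(K)=0$ and let $\chi:F\to K$ be a character. The following are equivalent: (1) $(F,K;\chi)$ is an $L$-substructure of a model of $\mathrm{ACFC}_p$; (2) $\chi$ is generic and $\mathrm{char}(F)=p$.
   Context: A character $\chi:F\to K$ between integral domains is a map with $\chi(ab)=\chi(a)\chi(b)$ for all $a,b\in F$, $\chi(0)=0$ and $\chi(1)=1$. A structure $(F,K;\chi)$ of this kind is a structure in the $2$-sorted language $L$, which consists of two disjoint copies of the language of rings (one for each sort) augmented by a unary function symbol $\chi$ from the first sort to the second. For $n\ge 1$, $\alpha\in F^n$ and $k\in\mathbb{N}^n$ put $\alpha^k=\alpha_1^{k_1}\cdots\alpha_n^{k_n}$. The tuple $\alpha$ is multiplicatively dependent if $\alpha^k=\alpha^l$ for some distinct $k,l\in\mathbb{N}^n$, and multiplicatively independent otherwise. A character $\chi:F\to K$ is generic if it is injective and, for every $n\ge1$ and every multiplicatively independent $\alpha\in F^n$, the tuple $\chi(\alpha)=(\chi(\alpha_1),\dots,\chi(\alpha_n))$ is algebraically independent, in the fraction field of $K$, over its prime field. $\mathrm{ACFC}$ is a recursive set of $\forall\exists$-sentences of $L$ whose models are exactly the structures $(F,K;\chi)$ with $F,K$ algebraically closed fields, $\mathrm{char}(K)=0$ and $\chi$ a generic character. For $p$ prime or zero, $\mathrm{ACFC}_p$ is $\mathrm{ACFC}$ together with sentences expressing $\mathrm{char}(F)=p$. *)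

(* Defs.v *)
From HB Require Import structures.
From mathcomp Require Import all_boot all_order all_algebra.
From mathcomp Require Import mpoly.

Set Implicit Arguments.
Unset Strict Implicit.
Unset Printing Implicit Defensive.

Import GRing.Theory.
Local Open Scope ring_scope.

(* [pchar R] is the set of primes vanishing in R; it is empty exactly when the
   integral domain R has characteristic 0. *)
Definition has_char (R : idomainType) (p : nat) : Prop :=
  if p == 0%N then [pchar R] =i pred0 else p \in [pchar R].

Definition is_character (F K : idomainType) (chi : F -> K) : Prop :=
  [/\ {morph chi : a b / a * b}, chi 0 = 0 & chi 1 = 1].

(* Exponent vectors in N^n are taken in 'X_{1..n}. *)
Definition mult_dependent (F : idomainType) (n : nat) (alpha : 'I_n -> F) :
    Prop :=
  exists k l : 'X_{1..n},
    k <> l /\ \prod_(i < n) alpha i ^+ k i = \prod_(i < n) alpha i ^+ l i.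

Definition mult_independent (F : idomainType) (n : nat) (alpha : 'I_n -> F) :
    Prop :=
  ~ mult_dependent alpha.

(* The intersection of all subfields of E. *)
Definition prime_field (E : fieldType) (x : E) : Prop :=
  forall S : {pred E}, divring_closed S -> x \in S.

Definition alg_independent_over (E : fieldType) (k : E -> Prop) (n : nat)
    (v : 'I_n -> E) : Prop :=
  forall P : {mpoly E[n]}, (forall m : 'X_{1..n}, k P@_m) ->
    P.@[v] = 0 -> P = 0.

Definition generic (F K : idomainType) (chi : F -> K) : Prop :=
  injective chi /\
  forall (n : nat) (alpha : 'I_n -> F), (0 < n)%N -> mult_independent alpha ->
    alg_independent_over (@prime_field {fraction K})
      (fun i : 'I_n => tofrac (chi (alpha i))).

(* (F, K; chi) is a model of ACFC_p: the class of models of the theory is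
   described semantically, without a syntax for its sentences. *)
Definition is_model_ACFC (p : nat) (F K : closedFieldType) (chi : F -> K) :
    Prop :=
  [/\ has_char F p, has_char K 0, is_character chi & generic chi].

(* (F, K; chi) is a substructure of (F', K'; chi'), up to isomorphism, for the
   two-sorted language with two copies of the language of rings and a function
   symbol for the character: it embeds in (F', K'; chi'). *)
Definition is_substructure (F K F' K' : idomainType) (chi : F -> K)
    (chi' : F' -> K') : Prop :=
  exists (f : {rmorphism F -> F'}) (g : {rmorphism K -> K'}),
    [/\ injective f, injective g & forall a : F, g (chi a) = chi' (f a)].

(* Main.v *)
Require Import Defs.
From HB Require Import structures.
From mathcomp Require Import all_boot all_order all_algebra.
From mathcomp Require Import mpoly.
From mathcomp Require Import closed_field boolp classical_sets.

(** A generic character restricts to a generic character on a substructure,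
    because an injective morphism preserves multiplicative independence and
    reflects algebraic independence; this gives the passage from (1) to (2).

    For the converse, let [L] be an algebraically closed field containing [F]
    and [K0] one containing [K]; algebraic closures are constructed from
    ultraproducts of splitting fields. The point is to extend [chi] to the
    multiplicative group of [L], after enlarging [K0]. On the group of
    fractions of [F] the extension is forced ([generic_on_fractions]). Then
    one element [h] is adjoined to the domain [H] at a time:
    - if some power of [h] is in [H], reduce to a power [h ^ q] with [q] prime;
      the image of [h] is a [q]-th root of [chi (h ^ q)] outside [chi H], which
      exists because [K0] contains the [q]-th roots of unity
      ([generic_on_adjoin_root]);
    - otherwise the image of [h] is an element transcendental over [K0]
      ([generic_on_adjoin_transcendental]).

    Genericity survives because it is carried along in the form [generic_on]:
    besides injectivity, any finitely many elements of [H] have, for some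
    [N > 0], their [N]-th powers in a subgroup whose distinct elements have
    linearly independent images. This does imply algebraic independence of the
    images of multiplicatively independent elements
    ([int_independent_of_generic_on]), since a nontrivial polynomial relation
    between some elements gives one between their [N]-th powers
    ([power_relation]).

    Finite extensions of the domain are glued into a character on all of [L]
    by an ultraproduct of their targets, indexed by the finite subsets of [L]
    ([generic_on_full_extension]); the algebraic closure of the ultraproduct
    is the field [K'] of a model. *)

Set Implicit Arguments.
Unset Strict Implicit.
Unset Printing Implicit Defensive.

Import GRing.Theory.
Local Open Scope ring_scope.

(** * Residue fields and ultraproducts *)

Section MaximalIdeal.
Local Open Scope quotient_scope.
Variable R : comNzRingType.

Definition ideal (J : R -> Prop) : Prop :=
  [/\ J 0, forall a b, J a -> J b -> J (a + b) & forall a b, J b -> J (a * b)].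

(** Maximality is stated in the form that yields inverses: modulo [M], every
    element outside [M] is invertible. *)
Lemma maximal_ideal_exists (J : R -> Prop) : ideal J -> ~ J 1 ->
  exists M : R -> Prop,
    [/\ ideal M, ~ M 1, forall a, J a -> M a
      & forall a, ~ M a -> exists b c, M c /\ b * a + c = 1].
Proof.
move=> [J0 JD JM] J1.
(* The union of the empty chain is empty, so the empty set has to be
   admitted in the family to which Zorn's lemma is applied. *)
pose P (A : set R) := (forall a, ~ A a) \/
  [/\ ideal A, ~ A 1 & forall a, J a -> A a].
have [|M [[M0|[[M0 MD MM] M1 JM']] Mmax]] := @Zorn_bigcup R P.
- move=> C CP Ctot.
  have [[A CA [a Aa]]|nC] := pselect (exists2 A, C A & exists a, A a); last first.
    by left=> a [A CA Aa]; apply: nC; exists A => //; exists a.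
  have good B : C B -> forall b, B b ->
      [/\ ideal B, ~ B 1 & forall a, J a -> B a].
    by move=> CB b Bb; case: (CP B CB) => // /(_ b).
  have [[A0 AD AM] A1 JA] := good A CA a Aa.
  right; split; first split.
  + by exists A.
  + move=> x y [X CX Xx] [Y CY Yy].
    have [XY|YX] := Ctot X Y CX CY.
      by exists Y => //; have [[_ YD _] _ _] := good Y CY y Yy; apply: YD=> //;
          apply: XY.
    by exists X => //; have [[_ XD _] _ _] := good X CX x Xx; apply: XD=> //;
        apply: YX.
  + by move=> x y [Y CY Yy]; exists Y => //; have [[_ _ YM] _ _] := good Y CY y Yy;
      apply: YM.
  + by move=> [Y CY Yy]; have [_ Y1 _] := good Y CY 1 Yy.
  + by move=> x Jx; exists A => //; apply: JA.
- exfalso; apply: (Mmax J); last by right; split=> //; split.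
  by split=> [a /M0 //|/(_ 0 J0)]; apply: M0.
- exists M; split=> // a Ma.
  pose B (x : R) := exists b c, M c /\ b * a + c = x.
  have [//|B1] := pselect (B 1).
  exfalso; apply: (Mmax B).
    split; first by move=> x Mx; exists 0, x; rewrite mul0r add0r.
    by move=> /(_ a) BM; apply/Ma/BM; exists 1, 0; rewrite mul1r addr0.
  right; split=> //; last first.
    by move=> x Jx; exists 0, x; rewrite mul0r add0r; split=> //; apply: JM'.
  split; first by exists 0, 0; rewrite mul0r add0r.
  + move=> x y [b [c [Mc <-]]] [b' [c' [Mc' <-]]].
    by exists (b + b'), (c + c'); split; [apply: MD|rewrite mulrDl addrACA].
  + move=> x y [b [c [Mc <-]]].
    by exists (x * b), (x * c); split; [apply: MM|rewrite mulrDr mulrA].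
Qed.

(** The common source of root extensions and of ultraproducts: an ideal
    prescribes what must become zero, and the quotient by a maximal ideal above
    it is a field. *)
Lemma residue_field_exists (J : R -> Prop) : ideal J -> ~ J 1 ->
  exists (E : fieldType) (pi : {rmorphism R -> E}), forall a, J a -> pi a = 0.
Proof.
move=> idJ J1; have [M [[M0 MD MM] M1 JM Mmax]] := maximal_ideal_exists idJ J1.
pose I : {pred R} := fun a => `[< M a >].
have inI a : (a \in I) <-> M a by split=> [/asboolP|/asboolP].
have I1 : idealr_closed I.
  split; first exact/inI.
    by apply/negP=> /inI.
  by move=> a x y /inI Mx /inI My; apply/inI/MD => //; apply: MM.
pose mI := isIdealr.Build R I I1.
pose IR : idealr R := HB.pack I mI.
pose Q := {ideal_quot IR}.
have piE (a b : R) : (\pi_Q a == \pi_Q b) = (a - b \in I).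
  by rewrite piE.
have QU (x : Q) : x != 0 -> exists y : Q, y * x = 1.
  elim/quotW: x => a; rewrite -(rmorph0 (\pi_Q : {rmorphism R -> Q})) piE subr0.
  move=> /negP aI; have [|b [c [Mc E]]] := Mmax a; first by move/inI.
  exists (\pi b); rewrite -rmorphM -(rmorph1 (\pi_Q : {rmorphism R -> Q})).
  apply/eqP; rewrite piE -E opprD addrA subrr add0r; apply/inI.
  by rewrite -mulN1r; apply: MM.
pose inv (x : Q) : Q := 
  if pselect (exists y : Q, y * x = 1 /\ x != 0) is left h then projT1 (cid h) else 0.
have invP (x : Q) : x != 0 -> inv x * x = 1.
  move=> x0; rewrite /inv; case: pselect => [h|[]]; last by have [y] := QU x x0;
      exists y.
  by case: (cid h) => y [].
have inv0 : inv 0 = 0.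
  by rewrite /inv; case: pselect => // -[y []]; rewrite eqxx.
pose mF := GRing.ComNzRing_isField.Build Q invP inv0.
pose E : fieldType := HB.pack Q mF.
exists E, (\pi_Q : {rmorphism R -> Q}) => a Ja.
apply/eqP; rewrite -(rmorph0 (\pi_Q : {rmorphism R -> Q})) piE subr0.
by apply/inI/JM.
Qed.
End MaximalIdeal.

Section DependentProduct.
Variables (I : Type) (i0 : I) (E : I -> fieldType).

(** The index [i0] only records that [I] is inhabited: over an empty index
    type the product would be the zero ring, which [comNzRingType] excludes. *)
Definition dprod_of of I : Type := forall i, E i.
Local Notation T := (dprod_of i0).

HB.instance Definition _ := gen_eqMixin T.
HB.instance Definition _ := gen_choiceMixin T.

Implicit Types x y z : T.
Let zero : T := fun i => 0.
Let opp x : T := fun i => - x i.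
Let add x y : T := fun i => x i + y i.
Let one : T := fun i => 1.
Let mul x y : T := fun i => x i * y i.

Fact dprod_addA : associative add.
Proof. by move=> x y z; apply: functional_extensionality_dep => i; apply: addrA. Qed.
Fact dprod_addC : commutative add.
Proof. by move=> x y; apply: functional_extensionality_dep => i; apply: addrC. Qed.
Fact dprod_add0 : left_id zero add.
Proof. by move=> x; apply: functional_extensionality_dep => i; apply: add0r. Qed.
Fact dprod_addN : left_inverse zero opp add.
Proof. by move=> x; apply: functional_extensionality_dep => i; apply: addNr. Qed.
HB.instance Definition _ :=
  GRing.isZmodule.Build T dprod_addA dprod_addC dprod_add0 dprod_addN.
Fact dprod_mulA : associative mul.
Proof. by move=> x y z; apply: functional_extensionality_dep => i; apply: mulrA. Qed.
Fact dprod_mulC : commutative mul.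
Proof. by move=> x y; apply: functional_extensionality_dep => i; apply: mulrC. Qed.
Fact dprod_mul1 : left_id one mul.
Proof. by move=> x; apply: functional_extensionality_dep => i; apply: mul1r. Qed.
Fact dprod_mulDl : left_distributive mul add.
Proof. by move=> x y z; apply: functional_extensionality_dep => i; apply: mulrDl. Qed.
Fact dprod_one_neq0 : one != zero.
Proof.
apply/eqP => /(congr1 (fun x : T => x i0)) /eqP.
by rewrite /one /zero oner_eq0.
Qed.
HB.instance Definition _ := GRing.Zmodule_isComNzRing.Build T
  dprod_mulA dprod_mulC dprod_mul1 dprod_mulDl dprod_one_neq0.

Definition dprod_proj (i : I) (x : T) : E i := x i.
Fact dprod_proj_zmod (i : I) : zmod_morphism (dprod_proj i).
Proof. by []. Qed.
Fact dprod_proj_monoid (i : I) : monoid_morphism (dprod_proj i).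
Proof. by []. Qed.
HB.instance Definition _ i :=
  GRing.isZmodMorphism.Build T (E i) (dprod_proj i) (dprod_proj_zmod i).
HB.instance Definition _ i :=
  GRing.isMonoidMorphism.Build T (E i) (dprod_proj i) (dprod_proj_monoid i).

Section Diagonal.
Variables (R : pzRingType) (phi : forall i, {rmorphism R -> E i}).
Definition dprod_diag (a : R) : T := fun i => phi i a.
Fact dprod_diag_zmod : zmod_morphism dprod_diag.
Proof. by move=> a b; apply: functional_extensionality_dep => i; apply: rmorphB. Qed.
Fact dprod_diag_monoid : monoid_morphism dprod_diag.
Proof.
split; first by apply: functional_extensionality_dep => i; apply: rmorph1.
by move=> a b; apply: functional_extensionality_dep => i; apply: rmorphM.
Qed.
HB.instance Definition _ :=
  GRing.isZmodMorphism.Build R T dprod_diag dprod_diag_zmod.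
HB.instance Definition _ :=
  GRing.isMonoidMorphism.Build R T dprod_diag dprod_diag_monoid.
End Diagonal.
End DependentProduct.

(** Along a directed index, the eventually vanishing families form a proper
    ideal. In a quotient field by a maximal ideal above it, an eventually
    nonvanishing family stays nonzero because it is eventually invertible.
    So [U] satisfies each equation and each inequation that holds
    eventually: this is the form of compactness used twice below. *)
Lemma ultraproduct_exists (I : Type) (i0 : I) (le : I -> I -> Prop)
    (E : I -> fieldType) :
  (forall i, le i i) ->
  (forall i j, exists k, forall l, le k l -> le i l /\ le j l) ->
  exists (U : fieldType) (pi : {rmorphism dprod_of E i0 -> U}),
    (forall x : dprod_of E i0, (exists i, forall j, le i j -> x j = 0) -> pi x = 0) /\
    (forall x : dprod_of E i0, (exists i, forall j, le i j -> x j <> 0) -> pi x <> 0).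
Proof.
move=> lexx dir; pose J (x : dprod_of E i0) := exists i, forall j, le i j -> x j = 0.
have [||U [pi piJ]] := @residue_field_exists _ J.
- split; first by exists i0.
  + move=> x y [i xi] [j yj]; have [k kP] := dir i j.
    by exists k => l /kP [/xi xl /yj yl];
        rewrite -[(x + y) l]/(x l + y l) xl yl addr0.
  + by move=> x y [i yi]; exists i => j /yi yj;
      rewrite -[(x * y) j]/(x j * y j) yj mulr0.
- by move=> [i /(_ i (lexx i)) /eqP]; rewrite -[X in X == _]/1 oner_eq0.
exists U, pi; split=> // x [i xi] pix0.
pose y : dprod_of E i0 := fun j => (x j)^-1.
suff /eqP : 1 = 0 :> U by rewrite oner_eq0.
have -> : 1 = pi (x * y) :> U.
  rewrite -(rmorph1 pi); apply/eqP; rewrite -subr_eq0 -rmorphB; apply/eqP/piJ.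
  exists i => j /xi /eqP xj.
  by rewrite -[LHS]/(1 - x j * y j) /y divff ?subrr.
by rewrite rmorphM pix0 mul0r.
Qed.

(** * Algebraic closures *)

Lemma root_extension_exists (F : fieldType) (p : {poly F}) : (1 < size p)%N ->
  exists (E : fieldType) (phi : {rmorphism F -> E}) (r : E),
    root (map_poly phi p) r.
Proof.
move=> p1; have [||E [pi piP]] := @residue_field_exists _ (fun a => p %| a).
- by split=> [|a b|a b]; [exact: dvdp0|exact: dvdp_add|exact: dvdp_mull].
- by rewrite dvdp1 => /eqP p1'; rewrite p1' in p1.
exists E, (pi \o polyC : {rmorphism F -> E}), (pi 'X).
by rewrite /root map_poly_comp horner_map -/(p \Po 'X) comp_polyXr piP.
Qed.

Lemma splitting_field_exists (F : fieldType) (p : {poly F}) : p != 0 ->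
  exists (E : fieldType) (phi : {rmorphism F -> E}) (rs : seq E),
    map_poly phi p = phi (lead_coef p) *: \prod_(r <- rs) ('X - r%:P).
Proof.
have [n] := ubnP (size p); elim: n => // n IH in F p * => pn p0.
have [p1|p1] := leqP (size p) 1.
  exists F, idfun, [::]; rewrite big_nil map_poly_id //.
  have [c c0 ->] : exists2 c, c != 0 & p = c%:P.
    by apply/size_poly1P; rewrite eqn_leq p1 size_poly_gt0.
  by rewrite lead_coefC alg_polyC.
have [E [phi [r /factor_theorem [q qE]]]] := root_extension_exists p1.
have q0 : q != 0.
  by apply: contraNneq p0 => q0; rewrite -(map_poly_eq0 phi) qE q0 mul0r.
have qp : lead_coef q = phi (lead_coef p).
  by rewrite -lead_coef_map qE lead_coefM lead_coefXsubC mulr1.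
have [|//|E' [phi' [rs qE']]] := IH E q.
  have := size_map_poly phi p; rewrite qE size_Mmonic ?monicXsubC // size_XsubC.
  by rewrite addn2 /= => E1; rewrite E1.
exists E', (phi' \o phi : {rmorphism F -> E'}), (phi' r :: rs).
rewrite map_poly_comp qE rmorphM /= qE' qp big_cons -scalerAl mulrC.
by rewrite rmorphB /= map_polyX map_polyC.
Qed.

(** Index the splitting fields by the nonzero polynomials, ordered by
    divisibility. A given [p] splits in all the fields with index a multiple
    of [p], with the same number of roots in each, so the families made of
    the k-th roots for k < deg p are its roots in the ultraproduct. *)
Lemma simultaneous_splitting_field_exists (F : fieldType) :
  exists (E : fieldType) (phi : {rmorphism F -> E}),
    forall p : {poly F}, p != 0 -> exists rs : seq E,
      map_poly phi p = phi (lead_coef p) *: \prod_(r <- rs) ('X - r%:P).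
Proof.
pose I := {p : {poly F} | p != 0}.
have /choice [E] : forall i : I, exists E : fieldType,
   exists (phi : {rmorphism F -> E}) (rs : seq E),
    map_poly phi (val i) = phi (lead_coef (val i)) *: \prod_(r <- rs) ('X - r%:P).
  by move=> [p p0]; apply: splitting_field_exists.
move=> /= EP.
pose phi i : {rmorphism F -> E i} := projT1 (cid (EP i)).
have phiP i : exists rs : seq (E i), map_poly (phi i) (val i) =
    phi i (lead_coef (val i)) *: \prod_(r <- rs) ('X - r%:P).
  exact: (projT2 (cid (EP i))).
pose le (i j : I) := val i %| val j.
pose i0 : I := exist _ 1 (oner_neq0 _).
have [i|i j|U [pi [piE _]]] := @ultraproduct_exists I i0 le E; first exact: dvdpp.
  have ij0 : val i * val j != 0 by rewrite mulf_neq0 ?(valP i) ?(valP j).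
  exists (Sub (val i * val j) ij0 : I) => l; rewrite /le /= => H.
  by split; apply: dvdp_trans H; [apply: dvdp_mulr|apply: dvdp_mull].
pose phiU : {rmorphism F -> U} := pi \o dprod_diag i0 phi.
exists U, phiU => p p0; pose i : I := exist _ p p0.
have [rs rsP] : exists rs : forall j, seq (E j), forall j, le i j ->
    size (rs j) = (size p).-1 /\
    map_poly (phi j) p = phi j (lead_coef p) *: \prod_(r <- rs j) ('X - r%:P).
  suff H j : exists rs : seq (E j), le i j -> size rs = (size p).-1 /\
    map_poly (phi j) p = phi j (lead_coef p) *: \prod_(r <- rs) ('X - r%:P).
    by exists (fun j => projT1 (cid (H j))) => j; apply: (projT2 (cid (H j))).
  have [rs rsP] := phiP j.
  have [ij|nij] := boolP (val i %| val j); last by exists [::] => ij;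
      case: (negP nij).
  have : map_poly (phi j) p %| \prod_(r <- rs) ('X - r%:P).
    have : map_poly (phi j) p %| map_poly (phi j) (val j) by rewrite dvdp_map.
    by rewrite rsP dvdpZr // fmorph_eq0 lead_coef_eq0 (valP j).
  move=> /dvdp_prod_XsubC [m mE].
  exists (mask m rs) => _.
  move: mE; set q := \prod_(r <- _) _ => mE.
  have mq : q \is monic by apply: monic_prod_XsubC.
  have pE : map_poly (phi j) p = phi j (lead_coef p) *: q.
    by rewrite -lead_coef_map -(eqp_eq mE) (monicP mq) scale1r.
  split=> //; have := size_map_poly (phi j) p; rewrite pE size_scale.
    by rewrite size_prod_XsubC => <-.
  by rewrite fmorph_eq0 lead_coef_eq0.
pose r k : dprod_of E i0 := fun j => nth 0 (rs j) k.
exists [seq pi (r k) | k <- iota 0 (size p).-1].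
(* [P] is the difference of the two sides of the factorization over the
   product ring; its coefficients vanish eventually. *)
pose P : {poly dprod_of E i0} :=
  map_poly (dprod_diag i0 phi) p - dprod_diag i0 phi (lead_coef p) *:
   \prod_(k <- iota 0 (size p).-1) ('X - (r k)%:P).
have : map_poly pi P = 0.
  apply/polyP => k; rewrite coef_map coef0; apply: piE; exists i => j /rsP [sz pE].
  rewrite -[LHS]/(dprod_proj j (P`_k)) -coef_map rmorphB /= map_polyZ /=.
  rewrite rmorph_prod -map_poly_comp /=.
  have -> : map_poly (dprod_proj j \o dprod_diag i0 phi) p = map_poly (phi j) p by [].
  rewrite pE (big_nth 0) sz /index_iota subn0 -[dprod_proj _ _]/(phi j _).
  rewrite [X in _ - _ *: X](eq_bigr (fun k => 'X - (nth 0 (rs j) k)%:P)) ?subrr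
      ?coef0 // => l _.
  by rewrite rmorphB /= map_polyX map_polyC.
rewrite rmorphB /= map_polyZ /= rmorph_prod -map_poly_comp => /eqP.
rewrite subr_eq0 => /eqP ->; rewrite big_map; congr (_ *: _).
by apply: eq_bigr => k _; rewrite rmorphB /= map_polyX map_polyC.
Qed.

Section AlgebraicElements.
Variables (F E : fieldType) (phi : {rmorphism F -> E}).

Definition algebraic_pred : {pred E} := fun x => `[< algebraicOver phi x >].

Lemma algebraic_predP x : reflect (algebraicOver phi x) (x \in algebraic_pred).
Proof. exact: asboolP. Qed.

Fact algebraic_divring_closed : divring_closed algebraic_pred.
Proof.
split; first by apply/algebraic_predP/algebraic1.
  by move=> x y /algebraic_predP ? /algebraic_predP ?;
      apply/algebraic_predP/algebraic_sub.
by move=> x y /algebraic_predP ? /algebraic_predP ?;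
    apply/algebraic_predP/algebraic_div.
Qed.
HB.instance Definition _ :=
  GRing.isDivringClosed.Build E algebraic_pred algebraic_divring_closed.

Record algebraic_elt := AlgebraicElt {
  algebraic_val :> E; _ : algebraic_val \in algebraic_pred }.
HB.instance Definition _ := [isSub for algebraic_val].
HB.instance Definition _ := [Choice of algebraic_elt by <:].
HB.instance Definition _ := [SubChoice_isSubComUnitRing of algebraic_elt by <:].
HB.instance Definition _ :=
    [SubComUnitRing_isSubIntegralDomain of algebraic_elt by <:].
HB.instance Definition _ := [SubIntegralDomain_isSubField of algebraic_elt by <:].

Fact algebraic_phi a : phi a \in algebraic_pred.
Proof. by apply/algebraic_predP/algebraic_id. Qed.
Definition to_algebraic_elt a : algebraic_elt := AlgebraicElt (algebraic_phi a).
Fact to_algebraic_elt_zmod : zmod_morphism to_algebraic_elt.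
Proof. by move=> a b; apply: val_inj; rewrite rmorphB /= rmorphB. Qed.
Fact to_algebraic_elt_monoid : monoid_morphism to_algebraic_elt.
Proof.
by split=> [|a b]; apply: val_inj; rewrite /= ?rmorph1 // ?rmorphM /= ?rmorphM.
Qed.
HB.instance Definition _ :=
  GRing.isZmodMorphism.Build F algebraic_elt to_algebraic_elt to_algebraic_elt_zmod.
HB.instance Definition _ :=
  GRing.isMonoidMorphism.Build F algebraic_elt to_algebraic_elt
      to_algebraic_elt_monoid.

(** A root, in some larger field, of a polynomial with algebraic coefficients
    is itself algebraic over [F]. It is therefore a root of a polynomial over
    [F], and all of those already lie in [E]. *)
Lemma algebraic_elt_closed :
  (forall p : {poly F}, p != 0 -> exists rs : seq E,
      map_poly phi p = phi (lead_coef p) *: \prod_(r <- rs) ('X - r%:P)) ->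
  GRing.closed_field_axiom algebraic_elt.
Proof.
move=> split n P n0.
pose q : {poly algebraic_elt} := 'X^n - \poly_(i < n) P i.
have sq : size q = n.+1.
  by rewrite /q size_polyDl ?size_polyXn // size_polyN ltnS size_poly.
have [|L [psi [r rootr]]] := @root_extension_exists _ (map_poly val q).
  by rewrite size_map_poly sq.
have q0 : map_poly val q != 0 :> {poly E} by rewrite map_poly_eq0 -size_poly_eq0 sq.
have qA i : algebraicOver phi (map_poly val q)`_i.
  by apply/algebraic_predP; rewrite coef_map; apply: (valP q`_i).
have [f f0 rootf] : algebraicOver (psi \o phi) r.
  apply/integral_algebraic; apply: integral_root rootr _;
      first by rewrite map_poly_eq0.
  move=> /= _ /(nthP 0) [i _ <-]; rewrite coef_map;
      apply/integral_rmorph/integral_algebraic/qA.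
have [rs rsE] := split f f0.
have [s sE] : exists s, r = psi s.
  move: rootf; rewrite map_poly_comp rsE map_polyZ rootZ.
    by rewrite rmorph_prod /=;
        under eq_bigr do rewrite rmorphB /= map_polyX map_polyC;
       rewrite -(big_map psi xpredT (fun x => 'X - x%:P)) root_prod_XsubC => /mapP
           [s _ ->]; exists s.
  by rewrite !fmorph_eq0 lead_coef_eq0.
rewrite sE fmorph_root in rootr.
have sA : s \in algebraic_pred.
  apply/algebraic_predP/integral_algebraic; apply: integral_root rootr _ => //.
  by move=> /= _ /(nthP 0) [i _ <-]; apply/integral_algebraic/qA.
exists (AlgebraicElt sA); apply: val_inj; apply/eqP.
rewrite rmorphXn rmorph_sum /= -subr_eq0; move: rootr.
have -> : map_poly val q = 'X^n - map_poly val (\poly_(i < n) P i) :> {poly E}.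
  by rewrite rmorphB; congr (_ - _); apply: map_polyXn.
rewrite /root hornerD hornerN hornerXn.
rewrite (@horner_coef_wide _ n); last by rewrite size_map_poly size_poly.
congr (_ - _ == 0); apply: eq_bigr => i _.
by rewrite coef_map coef_poly ltn_ord -[s]/(val (AlgebraicElt sA)) -rmorphXn -rmorphM.
Qed.
End AlgebraicElements.

Lemma algebraic_closure_exists (F : fieldType) :
  exists (E : closedFieldType), inhabited {rmorphism F -> E}.
Proof.
have [E [phi split]] := simultaneous_splitting_field_exists F.
pose mE := Field_isAlgClosed.Build (algebraic_elt phi) (algebraic_elt_closed split).
pose C : closedFieldType := HB.pack (algebraic_elt phi) mE.
by exists C; split; apply: (to_algebraic_elt phi : {rmorphism F -> algebraic_elt
    phi}).
Qed.

(** * Algebraic and multiplicative independence *)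

(** Over a field of characteristic 0 this is algebraic independence over the
    prime field, with denominators cleared; see
    [alg_independent_over_prime_field]. *)
Definition int_independent (K : comNzRingType) (n : nat) (v : 'I_n -> K) : Prop :=
  forall P : {mpoly int[n]}, mmap intr v P = 0 -> P = 0.

Lemma mmap_intr_rmorph (K K' : comNzRingType) (g : {rmorphism K -> K'}) (n : nat)
    (v : 'I_n -> K) (P : {mpoly int[n]}) :
  g (mmap intr v P) = mmap intr (g \o v) P.
Proof.
rewrite /mmap rmorph_sum; apply: eq_bigr => m _; rewrite rmorphM rmorph_int.
by rewrite /mmap1 rmorph_prod; congr (_ * _); apply: eq_bigr => i _; rewrite rmorphXn.
Qed.

Lemma eq_mmap_intr (K : comNzRingType) (n : nat) (v w : 'I_n -> K)
    (P : {mpoly int[n]}) : v =1 w -> mmap intr v P = mmap intr w P.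
Proof.
by move=> vw; apply: eq_bigr => m _; congr (_ * _); apply: mmap1_eq.
Qed.

Section Power.
Variables (n N : nat).
Hypothesis N_gt0 : (0 < N)%N.

Let power_subst : {rmorphism {mpoly int[n]} -> {mpoly int[n]}} :=
  mmap (@mpolyC n int) (fun i => 'X_i ^+ N).

(** The substitution [X_i := X_i ^ N] makes the polynomial ring integral over
    itself, since [X_i] is a root of [T ^ N - X_i ^ N]. *)
Lemma integral_power_subst (P : {mpoly int[n]}) : integralOver power_subst P.
Proof.
have intX i : integralOver power_subst 'X_i.
  exists ('X^N - ('X_i)%:P); first by rewrite monicXnsubC.
  rewrite /root rmorphB /= map_polyXn map_polyC hornerD hornerN hornerXn hornerC /=.
  by rewrite mmapX mmap1U subrr.
rewrite [P]mpolyE; apply: big_ind => [||m _]; first exact: integral0.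
  by move=> x y; apply: integral_add.
rewrite -mul_mpolyC; apply: integral_mul.
  by have := integral_id power_subst (P@_m)%:MP; rewrite /= mmapC.
rewrite mpolyXE_id; apply: big_ind => [||i _]; first exact: integral1.
  by move=> x y; apply: integral_mul.
elim: (m i) => [|k IH]; first by rewrite expr0; apply: integral1.
by rewrite exprS; apply: integral_mul.
Qed.

(** A relation between the [z_i] yields one between their [N]-th powers,
    independent of [z]: in a relation of integrality of [P] over [Z[X ^ N]],
    the lowest nonzero coefficient, read in [Z[X ^ N]], is a multiple of [P].
    Hence extracting roots preserves algebraic independence. *)
Lemma power_relation (P : {mpoly int[n]}) : P != 0 ->
  exists2 Q : {mpoly int[n]}, Q != 0
    & forall (K : comNzRingType) (z : 'I_n -> K),
        mmap intr z P = 0 -> mmap intr (fun i => z i ^+ N) Q = 0.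
Proof.
move=> P0; have [q q1 qP] := integral_power_subst P.
have {q q1 qP} [Q Q0 [R QE]] : exists2 Q, Q != 0 & exists R, power_subst Q = R * P.
  have {q1} := monic_neq0 q1; elim/poly_ind: q qP => [|q Q IH]; first by rewrite eqxx.
  rewrite /root rmorphD rmorphM /= map_polyX map_polyC hornerMXaddC => qP q0.
  have [Q0|Q0] := eqVneq Q 0; last first.
    exists Q => //; exists (- (map_poly power_subst q).[P]).
    by apply/eqP; rewrite mulNr -addr_eq0 addrC.
  apply: IH; first by move: qP; rewrite Q0 raddf0 addr0 mulf_eq0 (negPf P0) orbF.
  by apply: contraNneq q0 => ->; rewrite mul0r add0r Q0.
exists Q => // K z Pz0.
pose ev : {rmorphism {mpoly int[n]} -> K} := mmap intr z.
have : ev (power_subst Q) = 0 by rewrite QE rmorphM [ev P]Pz0 mulr0.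
rewrite /= [X in ev X]/mmap rmorph_sum => E; rewrite -[RHS]E; apply: eq_bigr => m _.
rewrite rmorphM [ev _%:MP]mmapC; congr (_ * _); rewrite /mmap1 rmorph_prod.
by apply: eq_bigr => i _; rewrite !rmorphXn [ev 'X_i]mmapX mmap1U.
Qed.
End Power.

(** In characteristic 0, the [chi d] for distinct [d] in [D] are linearly
    independent over the rationals. *)
Definition lin_independent_on (L K : nzRingType) (D : L -> Prop) (chi : L -> K) :=
  forall (s : seq L) (c : L -> int), uniq s -> (forall x, x \in s -> D x) ->
    \sum_(x <- s) (c x)%:~R * chi x = 0 -> forall x, x \in s -> c x = 0.

Lemma lin_independent_on_family (L K : nzRingType) (D : L -> Prop) (chi : L -> K)
    (T : eqType) (s : seq T) (e : T -> L) (c : T -> int) :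
  lin_independent_on D chi -> uniq s -> {in s &, injective e} ->
  (forall t, t \in s -> D (e t)) ->
  \sum_(t <- s) (c t)%:~R * chi (e t) = 0 -> forall t, t \in s -> c t = 0.
Proof.
case: s => // t0 s; set s' := t0 :: s => liD us inje De sum0.
pose c' x := c (nth t0 s' (index x (map e s'))).
have ume : uniq (map e s') by rewrite map_inj_in_uniq.
have c'E t : t \in s' -> c' (e t) = c t.
  move=> ts; rewrite /c' -{1}(nth_index t0 ts) -(nth_map t0 (e t0)) ?index_mem //.
  by rewrite index_uniq ?nth_index ?size_map ?index_mem.
move=> t ts; rewrite -c'E //; apply: (liD (map e s')) => //; last exact: map_f.
  by move=> _ /mapP [u us' ->]; apply: De.
rewrite big_map -[RHS]sum0; apply: eq_big_seq => u us'.
by rewrite c'E.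
Qed.

Definition mult_subgroup (L : fieldType) (H : L -> Prop) : Prop :=
  [/\ H 1, ~ H 0, forall x y, H x -> H y -> H (x * y) & forall x, H x -> H x^-1].

(** A generic character on a multiplicative subgroup [H], as a total function
    constrained on [H] only. The last clause replaces algebraic
    independence of images: up to a common power, finitely many elements of
    [H] lie in a subgroup [D] on which [chi] is linearly independent. It
    says nothing about torsion, which no algebraic independence can see, and
    it is immediately inherited when a root of an element of [H] is added. *)
Definition generic_on (L K : fieldType) (H : L -> Prop) (chi : L -> K) : Prop :=
  [/\ mult_subgroup H, chi 1 = 1,
      forall x y, H x -> H y -> chi (x * y) = chi x * chi y,
      forall x y, H x -> H y -> chi x = chi y -> x = y
    & forall s : seq L, (forall x, x \in s -> H x) ->
        exists (N : nat) (D : L -> Prop),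
          [/\ (0 < N)%N, mult_subgroup D, forall x, D x -> H x,
              lin_independent_on D chi & forall x, x \in s -> D (x ^+ N)]].

Section Subgroup.
Variables (L : fieldType) (H : L -> Prop).
Hypothesis HH : mult_subgroup H.

Lemma subgroupX x n : H x -> H (x ^+ n).
Proof.
have [H1 _ HM _] := HH.
by move=> Hx; elim: n => [|n IH]; rewrite ?expr0 // exprS; apply: HM.
Qed.

Lemma subgroup_prod (I : Type) (r : seq I) (f : I -> L) :
  (forall i, H (f i)) -> H (\prod_(i <- r) f i).
Proof. by have [H1 _ HM _] := HH; move=> Hf; apply: big_ind. Qed.

Lemma subgroup_neq0 x : H x -> x != 0.
Proof. by have [_ H0 _ _] := HH => Hx; apply/eqP => x0; apply: H0; rewrite -x0. Qed.

Variables (K : fieldType) (chi : L -> K).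
Hypotheses (chi1 : chi 1 = 1)
  (chiM : forall x y, H x -> H y -> chi (x * y) = chi x * chi y).

Lemma chiX x n : H x -> chi (x ^+ n) = chi x ^+ n.
Proof.
by move=> Hx; elim: n => [|n IH]; rewrite ?expr0 // !exprS chiM ?IH //;
    apply: subgroupX.
Qed.

Lemma chi_prod (I : Type) (r : seq I) (f : I -> L) :
  (forall i, H (f i)) -> chi (\prod_(i <- r) f i) = \prod_(i <- r) chi (f i).
Proof.
move=> Hf; elim: r => [|i r IH]; first by rewrite !big_nil.
by rewrite !big_cons chiM ?IH //; apply: subgroup_prod.
Qed.
End Subgroup.

(** Replace [alpha] by its powers in [D]: these are still multiplicatively
    independent, so their monomials are distinct elements of [D], and a
    polynomial relation between their images is a forbidden linear relation.
    [power_relation] allows the passage to powers. *)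
Lemma int_independent_of_generic_on (L K : fieldType) (H : L -> Prop) (chi : L -> K)
    (n : nat) (alpha : 'I_n -> L) :
  generic_on H chi -> (forall i, H (alpha i)) -> mult_independent alpha ->
  int_independent (chi \o alpha).
Proof.
move=> [HH chi1 chiM _ virt] Ha indep P Pchi.
have [//|P0] := eqVneq P 0.
have [x|N [D [N0 DD DH liD DX]]] := virt (codom alpha).
  by move=> /codomP [i ->].
have {}DX i : D (alpha i ^+ N) by apply/DX/codom_f.
have [Q /eqP Qn0 /(_ _ _ Pchi) Q0] := power_relation N0 P0; case: Qn0.
pose e (m : 'X_{1..n}) := \prod_i (alpha i ^+ N) ^+ m i.
apply/mpolyP => m; rewrite mcoeff0.
have [mQ|/memN_msupp_eq0 //] := boolP (m \in msupp Q).
apply: (lin_independent_on_family (e := e) (c :=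
    fun m => Q@_m) liD (msupp_uniq Q) _ _ _ mQ).
- move=> m1 m2 _ _ e12; have [//|m12] := eqVneq m1 m2; case: indep.
  exists [multinom (N * m1 i)%N | i < n], [multinom (N * m2 i)%N | i < n]; split.
    move=> E; case/eqP: m12; apply/mnmP => i.
    move/mnmP/(_ i): E; rewrite !mnmE => /eqP.
    by rewrite eqn_pmul2l // => /eqP.
  move: e12; rewrite /e => e12.
  under eq_bigr do rewrite mnmE exprM.
  by under [RHS]eq_bigr do rewrite mnmE exprM.
- by move=> t _; apply: subgroup_prod => // i; apply: subgroupX.
- rewrite -[RHS]Q0; apply: eq_bigr => t _; congr (_ * _).
  rewrite (chi_prod HH) //; last by move=> i; do 2!apply: subgroupX => //.
  by apply: eq_bigr => i _; rewrite !(chiX HH) //; apply: subgroupX.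
Qed.

(** * The character on the group of fractions *)

Section Monomials.
Variables (n : nat) (R : comNzRingType) (v : 'I_n -> R).

Lemma mmap1Mn (k : 'X_{1..n}) N : mmap1 v (k *+ N) = mmap1 v k ^+ N.
Proof.
rewrite /mmap1 -prodrXl; apply: eq_bigr => i _.
by rewrite mulmnE exprM.
Qed.

Lemma mmap1Dm (k l : 'X_{1..n}) : mmap1 v (k + l) = mmap1 v k * mmap1 v l.
Proof. by apply: commr_mmap1_M => i x; apply: mulrC. Qed.
End Monomials.

Lemma mmap1_neq0 (n : nat) (R : idomainType) (v : 'I_n -> R) (k : 'X_{1..n}) :
  (forall i, v i != 0) -> mmap1 v k != 0.
Proof. by move=> v0; apply/prodf_neq0 => i _; rewrite expf_neq0. Qed.

(** Finitely many nonzero elements have a finite multiplicatively independent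
    family on which each depends up to a power. Elements are adjoined one at
    a time: if [x] is dependent on [gamma], then in the relation the exponents
    of [x] on the two sides differ, as [gamma] is independent. *)
Lemma mult_basis_exists (F : idomainType) (s : seq F) :
  (forall x, x \in s -> x != 0) ->
  exists (n : nat) (gamma : 'I_n -> F) (N : nat),
    [/\ mult_independent gamma, forall i, gamma i != 0, (0 < N)%N
      & forall x, x \in s -> exists k l : 'X_{1..n},
          x ^+ N * mmap1 gamma k = mmap1 gamma l].
Proof.
elim: s => [_|x s IH s0].
  exists 0%N, (fun=> 1), 1%N; split=> //; last by move=> i; rewrite oner_eq0.
  by move=> [k [l [kl _]]]; apply: kl; apply/mnmP => -[].
have [y ys|n [gamma [N [ind g0 N0 powN]]]] := IH.
  by apply: s0; rewrite inE ys orbT.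
have x0 : x != 0 by apply: s0; rewrite mem_head.
pose gamma' (i : 'I_n.+1) := oapp gamma x (unlift ord0 i).
have gamma'E (k : 'X_{1..n.+1}) :
    mmap1 gamma' k = x ^+ k ord0 * mmap1 gamma [multinom k (lift ord0 i) | i < n].
  rewrite /mmap1 big_ord_recl /gamma' unlift_none; congr (_ * _).
  by apply: eq_bigr => i _; rewrite liftK mnmE.
have [[k [l [kl klE]]]|ind'] := pselect (mult_dependent gamma'); last first.
  exists n.+1, gamma', N; split=> //.
    by move=> i; rewrite /gamma'; case: (unlift ord0 i).
  pose lft (k : 'X_{1..n}) := [multinom oapp k 0%N (unlift ord0 i) | i < n.+1].
  have lftE k : mmap1 gamma' (lft k) = mmap1 gamma k.
    rewrite gamma'E mnmE unlift_none expr0 mul1r; congr mmap1.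
    by apply/mnmP => i; rewrite !mnmE liftK.
  move=> y; rewrite inE => /predU1P [->|/powN [k [l E]]]; last first.
    by exists (lft k), (lft l); rewrite !lftE.
  exists 0%MM, (U_(ord0) *+ N)%MM; rewrite mmap11 mulr1 mmap1Mn mmap1U.
  by rewrite /gamma' unlift_none.
suff [M [M0 [u [w Muw]]]] : exists M, (0 < M)%N /\ exists u w : 'X_{1..n},
    x ^+ M * mmap1 gamma u = mmap1 gamma w.
  exists n, gamma, (N * M)%N; split=> //; first by rewrite muln_gt0 N0.
  move=> y; rewrite inE => /predU1P [->|/powN [k' [l' E]]].
    by exists (u *+ N)%MM, (w *+ N)%MM; rewrite !mmap1Mn mulnC exprM -exprMn Muw.
  by exists (k' *+ M)%MM, (l' *+ M)%MM; rewrite !mmap1Mn exprM -exprMn E.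
wlog lt_kl : k l kl klE / (k ord0 < l ord0)%N => [WL|].
  have [|lt_lk|kl0] := ltngtP (k ord0) (l ord0); first exact: WL.
    by apply: (WL l k) => //; apply: nesym.
  case: ind; exists [multinom k (lift ord0 i) | i < n],
      [multinom l (lift ord0 i) | i < n].
  split.
    move=> E; apply: kl; apply/mnmP => i; case: (unliftP ord0 i) => [j ->|-> //].
    by move/mnmP/(_ j): E; rewrite !mnmE.
  have : mmap1 gamma' k = mmap1 gamma' l by exact: klE.
  rewrite !gamma'E kl0.
  by move=> /(mulfI (expf_neq0 _ x0)); apply.
exists (l ord0 - k ord0)%N; split; first by rewrite subn_gt0.
exists [multinom l (lift ord0 i) | i < n], [multinom k (lift ord0 i) | i < n].
apply: (mulfI (expf_neq0 (k ord0) x0)).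
rewrite mulrA -exprD subnKC 1?ltnW // -!gamma'E.
exact/esym.
Qed.

Section Fractions.
Variables (F : idomainType) (L K : fieldType) (f : {rmorphism F -> L}) (psi : F -> K).

Definition fractions (x : L) : Prop := exists a b : F, [/\ a != 0, b != 0 &
    x = f a / f b].

Hypotheses (f_inj : injective f) (psi_inj : injective psi)
  (psiM : {morph psi : a b / a * b}) (psi0 : psi 0 = 0) (psi1 : psi 1 = 1).
Hypothesis psi_indep : forall (n : nat) (alpha : 'I_n -> F),
  mult_independent alpha -> int_independent (psi \o alpha).

Let f_neq0 a : a != 0 -> f a != 0.
Proof. by rewrite -(inj_eq f_inj) rmorph0. Qed.
Let psi_neq0 a : a != 0 -> psi a != 0.
Proof. by rewrite -(inj_eq psi_inj) psi0. Qed.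

Let psi_mmap1 (n : nat) (v : 'I_n -> F) (k : 'X_{1..n}) :
  psi (mmap1 v k) = mmap1 (psi \o v) k.
Proof.
rewrite /mmap1 (big_morph psi psiM psi1); apply: eq_bigr => i _ /=.
by elim: (k i) => [|j IH]; rewrite ?expr0 // !exprS psiM IH.
Qed.

Let fracE a b c d : b != 0 -> d != 0 -> f a / f b = f c / f d -> a * d = c * b.
Proof.
move=> /f_neq0 b0 /f_neq0 d0 /eqP; rewrite eqr_div // -!rmorphM /=.
by rewrite (inj_eq f_inj) => /eqP.
Qed.

Lemma fractions_subgroup : mult_subgroup fractions.
Proof.
split.
- by exists 1, 1; rewrite oner_eq0 rmorph1 divr1.
- move=> [a [b [/f_neq0 a0 /f_neq0 b0 /eqP]]].
  by rewrite eq_sym mulf_eq0 invr_eq0 (negPf a0) (negPf b0).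
- move=> _ _ [a [b [a0 b0 ->]]] [c [d [c0 d0 ->]]].
  by exists (a * c), (b * d); rewrite !mulf_neq0 // !rmorphM /= mulf_div.
- by move=> _ [a [b [a0 b0 ->]]]; exists b, a; rewrite invf_div.
Qed.

(** For [D] take the group generated by a multiplicative basis [gamma] of the
    numerators and denominators. Multiplying distinct elements of [D] by a
    common denominator turns them into distinct monomials in [gamma], whose
    images are linearly independent because [psi \o gamma] is algebraically
    independent. *)
Lemma generic_on_fractions : exists chi : L -> K,
  generic_on fractions chi /\ forall a, a != 0 -> chi (f a) = psi a.
Proof.
have /choice [chi chiP] : forall x, exists y : K, forall a b, a != 0 -> b != 0 ->
    x = f a / f b -> y = psi a / psi b.
  move=> x; have [[a [b [a0 b0 ->]]]|nx] := pselect (fractions x); last first.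
    by exists 0 => a b a0 b0 xE; case: nx; exists a, b.
  exists (psi a / psi b) => c d c0 d0 /(fracE b0 d0) E.
  by apply/eqP; rewrite eqr_div ?psi_neq0 // -!psiM E.
have chif a : a != 0 -> chi (f a) = psi a.
  by move=> a0; rewrite (chiP _ a 1) ?oner_neq0 ?rmorph1 ?psi1 ?divr1.
have chiM x y : fractions x -> fractions y -> chi (x * y) = chi x * chi y.
  move=> [a [b [a0 b0 xE]]] [c [d [c0 d0 yE]]].
  rewrite (chiP x a b) // (chiP y c d) // (chiP _ (a * c) (b * d)) ?mulf_neq0 //.
    by rewrite !psiM mulf_div.
  by rewrite xE yE !rmorphM /= mulf_div.
exists chi; split=> //; split=> //.
- exact: fractions_subgroup.
- by rewrite -(rmorph1 f) chif ?oner_neq0.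
- move=> x y [a [b [a0 b0 ->]]] [c [d [c0 d0 ->]]].
  rewrite (chiP _ a b) // (chiP _ c d) // => /eqP.
  rewrite eqr_div ?psi_neq0 // -!psiM (inj_eq psi_inj) => /eqP E.
  by apply/eqP; rewrite eqr_div ?f_neq0 // -!rmorphM /= E.
move=> s sH.
have /choice [num /choice [den ndP]] : forall x, exists a b : F, x \in s ->
    [/\ a != 0, b != 0 & x = f a / f b].
  move=> x; have [/sH [a [b ab]]|_] := boolP (x \in s); first by exists a, b.
  by exists 0, 0.
have [y|n [gamma [N [ind g0 N0 powN]]]] :=
    @mult_basis_exists F (map num s ++ map den s).
  by rewrite mem_cat => /orP [] /mapP [x /ndP [a0 b0 _] ->].
have gk0 (k : 'X_{1..n}) : mmap1 gamma k != 0 by apply: mmap1_neq0.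
pose D x := exists k l : 'X_{1..n}, x * f (mmap1 gamma k) = f (mmap1 gamma l).
have DE x k l : x * f (mmap1 gamma k) = f (mmap1 gamma l) ->
   x = f (mmap1 gamma l) / f (mmap1 gamma k).
  by move=> <-; rewrite mulfK ?f_neq0.
have DM x y : D x -> D y -> D (x * y).
  move=> [k [l E]] [k' [l' E']]; exists (k + k')%MM, (l + l')%MM.
  by rewrite !mmap1Dm !rmorphM /= mulrACA E E'.
have DV x : D x -> D x^-1.
  move=> [k [l E]]; exists l, k; rewrite (DE _ _ _ E) invf_div.
  by rewrite divfK ?f_neq0.
have DH x : D x -> fractions x.
  by move=> [k [l /DE ->]]; exists (mmap1 gamma l), (mmap1 gamma k); split.
exists N, D; split=> //; last first.
- move=> x xs; have [_ _ {1}->] := ndP x xs; rewrite expr_div_n.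
  have [|k [l E]] := powN (num x); first by rewrite mem_cat map_f.
  have [|k' [l' E']] := powN (den x); first by rewrite mem_cat map_f ?orbT.
  apply: DM; first by exists k, l; rewrite -rmorphXn -rmorphM /= E.
  by apply: DV; exists k', l'; rewrite -rmorphXn -rmorphM /= E'.
- move=> t c ut tD sum0.
  have [k kP] : exists k : 'X_{1..n}, forall x, x \in t ->
      exists l, x * f (mmap1 gamma k) = f (mmap1 gamma l).
    elim: t tD {ut sum0} => [_|x t IH tD]; first by exists 0%MM.
    have [k [l E]] := tD x (mem_head _ _).
    have [y yt|k' k'P] := IH; first by apply: tD; rewrite inE yt orbT.
    exists (k + k')%MM => y;
        rewrite inE mmap1Dm rmorphM => /predU1P [->|/k'P [l' E']].
      by exists (l + k')%MM; rewrite mmap1Dm rmorphM mulrA E.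
    by exists (l' + k)%MM; rewrite mmap1Dm rmorphM mulrCA E' mulrC.
  have /choice [l lP] : forall x, exists l, x \in t ->
      x * f (mmap1 gamma k) = f (mmap1 gamma l).
    move=> x; have [/kP [l E]|_] := boolP (x \in t); first by exists l.
    by exists 0%MM.
  pose P : {mpoly int[n]} := \sum_(x <- t) c x *: 'X_[l x].
  have P0 : P = 0.
    apply: (psi_indep ind); rewrite /P raddf_sum /=.
    transitivity ((\sum_(x <- t) (c x)%:~R * chi x) * psi (mmap1 gamma k)).
      rewrite mulr_suml; apply: eq_big_seq => x xt.
      rewrite mmapZ mmapX -mulrA; congr (_ * _).
      have := lP x xt => /(congr1 chi); rewrite chiM ?chif //.
      - by rewrite -psi_mmap1 => ->.
      - exact/DH/tD.
      - by exists (mmap1 gamma k), 1; rewrite oner_eq0 rmorph1 divr1.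
    by rewrite sum0 mul0r.
  move=> x xt; have /(congr1 (mcoeff (l x))) := P0.
  rewrite mcoeff0 /P raddf_sum /= (bigD1_seq x) //= mcoeffZ mcoeffX eqxx mulr1.
  rewrite big_seq_cond big1 ?addr0 // => y /andP [yt yx].
  rewrite mcoeffZ mcoeffX; case: eqP => [E|_]; last by rewrite mulr0.
  case/eqP: yx; apply: (mulIf (f_neq0 (gk0 k))).
  by rewrite (lP x xt) (lP y yt) E.
- split=> //; first by exists 0%MM, 0%MM; rewrite mul1r.
  move=> [k [l /eqP]]; rewrite mul0r eq_sym => E.
  by move: (f_neq0 (gk0 l)); rewrite E.
Qed.
End Fractions.

(** * Adjoining roots *)

Section Adjunction.
Variables (L K : fieldType) (H : L -> Prop) (chi : L -> K).
Hypotheses (HH : mult_subgroup H) (chi1 : chi 1 = 1)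
  (chiM : forall x y, H x -> H y -> chi (x * y) = chi x * chi y)
  (chi_inj : forall x y, H x -> H y -> chi x = chi y -> x = y).

Lemma subgroupXz x (i : int) : H x -> H (x ^ i).
Proof.
have [_ _ _ HV] := HH => Hx.
by case: i => n; [|apply: HV]; apply: subgroupX.
Qed.

Lemma chi_neq0 x : H x -> chi x != 0.
Proof.
have [_ _ _ HV] := HH => Hx; apply: contraPneq chi1 => chix0.
rewrite -(divff (subgroup_neq0 HH Hx)) chiM ?chix0 ?mul0r; last exact: HV; last by [].
by move/esym/eqP; rewrite oner_eq0.
Qed.

Lemma chiV x : H x -> chi x^-1 = (chi x)^-1.
Proof.
have [_ _ _ HV] := HH => Hx; apply: (mulfI (chi_neq0 Hx)).
by rewrite -chiM ?divff ?(subgroup_neq0 HH Hx) ?chi_neq0 //; apply: HV.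
Qed.

Lemma chiXz x (i : int) : H x -> chi (x ^ i) = chi x ^ i.
Proof.
move=> Hx; case: i => n; first exact: (chiX HH).
by rewrite -[LHS]/(chi (x ^+ n.+1)^-1) chiV ?(chiX HH) //; apply: subgroupX.
Qed.

Lemma image_subgroup : mult_subgroup (fun y => exists2 a, H a & y = chi a).
Proof.
have [H1 _ HM HV] := HH; split.
- by exists 1.
- by move=> [a /chi_neq0 /eqP aH /esym].
- by move=> _ _ [a aH ->] [b bH ->]; exists (a * b); [exact: HM|rewrite chiM].
- by move=> _ [a aH ->]; exists a^-1; [exact: HV|rewrite chiV].
Qed.

(** Bezout: 1 is an integral combination of [q] and [i]. *)
Lemma subgroup_prime_exponent x (q : nat) (i : int) : prime q -> x != 0 ->
  H (x ^+ q) -> H (x ^ i) -> ~~ (q %| i)%Z -> H x.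
Proof.
move=> q_prime x0 Hq Hi qi; have [_ _ HM _] := HH.
have /coprimezP [[u v] /= uv] : coprimez q i by rewrite /coprimez; move: qi;
    rewrite -prime_coprime.
rewrite -[x]expr1z -uv expfzDr // mulrC; apply: HM.
  by rewrite mulrC -exprz_exp; apply: subgroupXz.
by rewrite mulrC -exprz_exp; apply: subgroupXz.
Qed.

Definition adjoin (h : L) (x : L) : Prop := exists (i : int) (a : L),
    H a /\ x = h ^ i * a.

Lemma sub_adjoin h x : H x -> adjoin h x.
Proof. by exists 0, x; rewrite expr0z mul1r. Qed.

Lemma adjoin_gen h : adjoin h h.
Proof. by have [H1 _ _ _] := HH; exists 1, 1; rewrite expr1z mulr1. Qed.

Lemma adjoin_subgroup h : h != 0 -> mult_subgroup (adjoin h).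
Proof.
have [H1 H0 HM HV] := HH => h0; split.
- exact: sub_adjoin.
- move=> [i [a [/(subgroup_neq0 HH) a0 /esym /eqP]]].
  by rewrite mulf_eq0 (negPf a0) expfz_eq0 (negPf h0) andbF.
- move=> _ _ [i [a [Ha ->]]] [j [b [Hb ->]]]; exists (i + j), (a * b).
  by split; [exact: HM|rewrite expfzDr // mulrACA].
- move=> _ [i [a [Ha ->]]]; exists (- i), a^-1; split; first exact: HV.
  by rewrite invfM invr_expz.
Qed.

(** The hypothesis says that [z] satisfies over [chi H] exactly the relations
    that [h] satisfies over [H]; one direction makes the extension well
    defined, the other makes it injective. *)
Lemma character_adjoin (h : L) (z : K) : h != 0 -> z != 0 ->
  (forall (i : int) a, H a -> h ^ i = a <-> z ^ i = chi a) ->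
  exists chi' : L -> K,
    [/\ forall x y, adjoin h x -> adjoin h y -> chi' (x * y) = chi' x * chi' y,
        forall x y, adjoin h x -> adjoin h y -> chi' x = chi' y -> x = y
      & forall (i : int) a, H a -> chi' (h ^ i * a) = z ^ i * chi a].
Proof.
have [H1 H0 HM HV] := HH => h0 z0 hz.
(* An equality of two expressions is a relation on a single power. *)
have quot (M : fieldType) (t a b : M) (i j : int) : t != 0 -> a != 0 ->
    (t ^ i * a = t ^ j * b) <-> (t ^ (i - j) = b * a^-1).
  move=> t0 a0; rewrite expfzDr // -invr_expz.
  have tj : t ^ j != 0 by rewrite expfz_eq0 (negPf t0) andbF.
  split=> [E|/eqP]; first by apply/eqP; rewrite eqr_div // E mulrC.
  by rewrite eqr_div // mulrC [b * _]mulrC => /eqP; rewrite mulrC.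
have eq_iff i j a b : H a -> H b ->
    h ^ i * a = h ^ j * b <-> z ^ i * chi a = z ^ j * chi b.
  move=> Ha Hb; have HVa := HV _ Ha; have Hba := HM _ _ Hb HVa.
  have a0 := subgroup_neq0 HH Ha; have ca0 := chi_neq0 Ha.
  have baE : chi (b * a^-1) = chi b * (chi a)^-1 by rewrite chiM ?chiV.
  split=> [/(quot _ _ _ _ _ _ h0 a0)/(hz _ _ Hba)|/(quot _ _ _ _ _ _ z0 ca0)].
    by rewrite baE => /(quot _ _ _ _ _ _ z0 ca0).
  by rewrite -baE => /(hz _ _ Hba)/(quot _ _ _ _ _ _ h0 a0).
have /choice [chi' chi'P] : forall x, exists y, forall (i : int) a, H a ->
    x = h ^ i * a -> y = z ^ i * chi a.
  move=> x; have [xH|nx] := pselect (adjoin h x); last first.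
    by exists 0 => i a Ha xE; case: nx; exists i, a.
  case: xH => i [a [Ha ->]].
  by exists (z ^ i * chi a) => j b Hb /eq_iff; apply.
have chi'E i a : H a -> chi' (h ^ i * a) = z ^ i * chi a by move=> Ha; apply: chi'P.
exists chi'; split=> // _ _ [i [a [Ha ->]]] [j [b [Hb ->]]].
  rewrite mulrACA -expfzDr // (chi'E _ _ (HM _ _ Ha Hb)) (chi'E _ _ Ha) (chi'E _ _
      Hb).
  by rewrite expfzDr // chiM // mulrACA.
by rewrite (chi'E _ _ Ha) (chi'E _ _ Hb) => /eq_iff; apply.
Qed.
End Adjunction.

(** In characteristic 0 the polynomial [1 + X + ... + X ^ (q - 1)] does not
    vanish at 1. *)
Lemma prim_root_exists (K : closedFieldType) (q : nat) : [pchar K] =i pred0 ->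
  prime q -> exists2 zeta : K, zeta != 1 & zeta ^+ q = 1.
Proof.
move=> /pcharf0P charK q_prime.
have q0 : (0 < q)%N := prime_gt0 q_prime.
have [|zeta] := @closed_rootP K (\poly_(i < q) 1) _.
  by rewrite size_poly_eq ?oner_eq0 // eqn_leq leqNgt prime_gt1.
rewrite /root (@horner_coef_wide _ q) ?size_poly // => /eqP.
rewrite (eq_bigr (fun i : 'I_q => zeta ^+ i)); last first.
  by move=> i _; rewrite coef_poly ltn_ord mul1r.
move=> sum0; exists zeta.
  apply: contra_eq_neq sum0 => ->; under eq_bigr do rewrite expr1n.
  by rewrite sumr_const card_ord charK -lt0n.
by apply/eqP; rewrite -subr_eq0 subrX1 sum0 mulr0.
Qed.

Section RootAdjunction.
Variables (L : fieldType) (K : closedFieldType).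
Hypothesis charK : [pchar K] =i pred0.

(** The image of [h] must be a [q]-th root of [chi (h ^ q)] outside [chi H].
    If no element of [H] has the [q]-th power of [h], any root will do, by
    injectivity. If [h1] in [H] has, then [h / h1] is a nontrivial [q]-th root
    of unity and [chi h1 * zeta] works: were [zeta] the image of [u] in [H],
    then [u] would generate the [q]-th roots of unity, forcing [h] into [H]. *)
Lemma fresh_root_exists (H : L -> Prop) (chi : L -> K) (h : L) (q : nat) :
  generic_on H chi -> prime q -> h != 0 -> H (h ^+ q) -> ~ H h ->
  exists2 z, z ^+ q = chi (h ^+ q) & forall c, H c -> z <> chi c.
Proof.
move=> [HH chi1 chiM chi_inj _] q_prime h0 Hhq nHh.
have [H1 _ HM HV] := HH.
have q0 : (0 < q)%N := prime_gt0 q_prime.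
have [[h1 [Hh1 h1q]]|nroot] := pselect (exists h1, H h1 /\ h1 ^+ q = h ^+ q).
  have [zeta zeta1 zetaq] := prim_root_exists charK q_prime.
  have h10 := subgroup_neq0 HH Hh1.
  exists (chi h1 * zeta) => [|c Hc E].
    by rewrite exprMn zetaq mulr1 -(chiX HH) // h1q.
  pose u := c / h1; have Hu : H u by apply: HM => //; apply: HV.
  have uE : chi u = zeta.
    rewrite chiM ?(chiV HH) //; last exact: HV.
    by rewrite -E mulrAC mulfV ?mul1r // (chi_neq0 HH).
  have u1 : u != 1 by apply: contra_neq zeta1 => u1; rewrite -uE u1.
  have uq : u ^+ q = 1.
    by apply: chi_inj => //; [exact: subgroupX|rewrite (chiX HH) // uE zetaq].
  have [m prim_u /(primeP q_prime).2] := prim_order_exists q0 uq.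
  move=> /orP [] /eqP mE; rewrite mE in prim_u.
    by move: (prim_expr_order prim_u); rewrite expr1 => /eqP; rewrite (negPf u1).
  have [|i wE] := prim_rootP prim_u (_ : (h / h1) ^+ q = 1).
    by rewrite expr_div_n h1q divff // expf_neq0.
  case: nHh; rewrite -(divfK h10 h) wE; apply: HM => //.
  exact: subgroupX.
have [|z] := @closed_rootP K ('X^q - (chi (h ^+ q))%:P) _.
  by rewrite size_XnsubC // eqSS -lt0n.
rewrite /root hornerD hornerN hornerXn hornerC subr_eq0 => /eqP zq.
exists z => // c Hc E; apply: nroot; exists c; split=> //.
apply: chi_inj => //; first exact: subgroupX.
by rewrite (chiX HH) // -E.
Qed.

(** For prime [q], the powers [h ^ i] in [H] are those with [q] dividing [i],
    which are powers of [h ^ q]. The subgroups [D] are kept, with the exponent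
    multiplied by [q]. *)
Lemma generic_on_adjoin_prime_root (H : L -> Prop) (chi : L -> K) (h : L) (q : nat) :
  generic_on H chi -> prime q -> h != 0 -> H (h ^+ q) ->
  exists (H' : L -> Prop) (chi' : L -> K),
    [/\ generic_on H' chi', H' h, forall x, H x -> H' x
      & forall x, H x -> chi' x = chi x].
Proof.
move=> gen q_prime h0 Hhq.
have [Hh|nHh] := pselect (H h); first by exists H, chi.
have [z zq zH] := fresh_root_exists gen q_prime h0 Hhq nHh.
have [HH chi1 chiM chi_inj virt] := gen.
have [H1 _ HM HV] := HH.
have q0 : (0 < q)%N := prime_gt0 q_prime.
have z0 : z != 0.
  apply: contraTneq (chi_neq0 HH chi1 chiM Hhq) => z0.
  by rewrite -zq z0 expr0n gtn_eqF // eqxx.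
have [|chi' [chi'M chi'inj chi'E]] := character_adjoin HH chi1 chiM h0 z0.
  move=> i a Ha; have [/dvdzP [j ->]|qi] := boolP (q %| i)%Z.
    rewrite mulrC -!exprz_exp -[h ^ q]/(h ^+ q) -[z ^ q]/(z ^+ q) zq.
    rewrite -(chiXz HH) //; split=> [-> //|]; apply: chi_inj => //.
    exact: subgroupXz.
  split=> E.
    by case: nHh; apply: (subgroup_prime_exponent HH q_prime h0 Hhq (i := i));
        rewrite ?E.
  have HI := image_subgroup HH chi1 chiM.
  have [||c Hc zc] := subgroup_prime_exponent HI q_prime z0 (i := i) _ _ qi.
  - by exists (h ^+ q).
  - by exists a.
  - by case: (zH c Hc).
have chi'H x : H x -> chi' x = chi x.
  by move=> Hx; have := chi'E 0 x Hx; rewrite !expr0z !mul1r.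
exists (adjoin H h), chi'; split=> //; [split=> //| |].
- exact: adjoin_subgroup.
- by rewrite chi'H.
- move=> s sH; have [_ /mapP [x /sH [i [a [Ha ->]]] ->]|N [D [N0 DD DH liD sD]]] :=
      virt [seq x ^+ q | x <- s].
    rewrite exprMn; apply: HM; last exact: subgroupX.
    by rewrite -[(h ^ i) ^+ q]/((h ^ i) ^ q) exprzAC; apply: subgroupXz.
  exists (q * N)%N, D; split=> //; first by rewrite muln_gt0 q0.
  + by move=> x /DH; apply: sub_adjoin.
  + move=> t c ut tD sum0; apply: liD => //; rewrite -[RHS]sum0.
    by apply: eq_big_seq => x /tD /DH /chi'H ->.
  + by move=> x xs; rewrite exprM; apply/sD/map_f.
- exact: adjoin_gen.
- by move=> x; apply: sub_adjoin.
Qed.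

(** A root of arbitrary degree is reached through roots of prime degree. *)
Lemma generic_on_adjoin_root (H : L -> Prop) (chi : L -> K) (h : L) (m : nat) :
  (0 < m)%N -> generic_on H chi -> h != 0 -> H (h ^+ m) ->
  exists (H' : L -> Prop) (chi' : L -> K),
    [/\ generic_on H' chi', H' h, forall x, H x -> H' x
      & forall x, H x -> chi' x = chi x].
Proof.
have [k] := ubnP m; elim: k => // k IH in m H chi * => mk m0 gen h0 Hm.
have [m1|m1] := leqP m 1.
  have mE : m = 1%N by apply/eqP; rewrite eqn_leq m1.
  by rewrite mE expr1 in Hm; exists H, chi.
have q_prime := pdiv_prime m1; have q1 := prime_gt1 q_prime.
have mE : ((m %/ pdiv m) * pdiv m)%N = m by rewrite divnK // pdiv_dvd.
have m'0 : (0 < m %/ pdiv m)%N by rewrite divn_gt0 ?pdiv_gt0 // pdiv_leq.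
rewrite -mE exprM in Hm.
have [H' [chi' [gen' H'h HH' chi'E]]] :=
  generic_on_adjoin_prime_root gen q_prime (expf_neq0 _ h0) Hm.
have [|H'' [chi'' [gen'' H''h HH'' chi''E]]] := IH _ H' chi' _ m'0 gen' h0 H'h.
  by apply: (leq_trans (ltn_Pdiv q1 m0)); rewrite -ltnS.
exists H'', chi''; split=> // x Hx; first by apply/HH''/HH'.
by rewrite chi''E ?chi'E //; apply: HH'.
Qed.
End RootAdjunction.

(** * Adjoining an element with no power in the domain *)

Lemma generic_on_rmorph (L K K' : fieldType) (g : {rmorphism K -> K'})
    (H : L -> Prop) (chi : L -> K) :
  generic_on H chi -> generic_on H (g \o chi).
Proof.
move=> [HH chi1 chiM chi_inj virt]; split=> //= [|x y Hx Hy|x y Hx Hy|s sH].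
- by rewrite chi1 rmorph1.
- by rewrite chiM // rmorphM.
- by move/fmorph_inj; apply: chi_inj.
have [N [D [N0 DD DH liD sD]]] := virt s sH; exists N, D; split=> //.
move=> t c ut tD sum0; apply: liD => //; apply: (fmorph_inj g).
rewrite rmorph0 -[RHS]sum0 rmorph_sum; apply: eq_bigr => x _.
by rewrite rmorphM rmorph_int.
Qed.

(** When no power of [h] is in [H], the image of [h] is a new transcendental:
    [K'] contains a polynomial ring over [K]. *)
Section TranscendentalAdjunction.
Variables (L K K' : fieldType) (tau : {rmorphism {poly K} -> K'}).
Hypothesis tau_inj : injective tau.
Variables (H : L -> Prop) (chi : L -> K) (h : L).
Hypotheses (gen : generic_on H chi) (h_neq0 : h != 0)
  (h_free : forall m, (0 < m)%N -> ~ H (h ^+ m)).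

Let phi : {rmorphism K -> K'} := tau \o polyC.
Let t : K' := tau 'X.
Let t_neq0 : t != 0.
Proof. by rewrite -(rmorph0 tau) (inj_eq tau_inj) polyX_eq0. Qed.

Lemma transcendental_zpow (i : int) (a : L) : H a ->
  h ^ i = a <-> t ^ i = phi (chi a).
Proof.
have [HH chi1 chiM chi_inj _] := gen; have [H1 _ _ HV] := HH.
have Xn n c : t ^+ n = phi c -> n = 0%N.
  rewrite /t /phi -rmorphXn /= => /tau_inj /(congr1 (fun p : {poly K} => size p)).
  rewrite size_polyXn => E; have := size_polyC_leq1 c.
  by rewrite -E ltnS leqn0 => /eqP.
move=> Ha; case: i => [[|n]|n].
- rewrite !expr0z; split=> [<-|]; first by rewrite chi1 rmorph1.
  by rewrite -(rmorph1 phi) => /fmorph_inj; rewrite -chi1; apply: chi_inj.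
- split=> [E|/Xn //]; first by case: (@h_free n.+1) => //; rewrite [h ^+ _]E.
- split=> [E|E].
    case: (@h_free n.+1) => //.
    by rewrite -[h ^+ n.+1]invrK -[(h ^+ _)^-1]/(h ^ Negz n) E; apply: HV.
  have /Xn // : t ^+ n.+1 = phi (chi a)^-1.
  by rewrite fmorphV -E -[t ^ _]/((t ^+ n.+1)^-1) invrK.
Qed.

(** A subgroup [D] is replaced by the group generated by [D] and [h]. In a
    linear relation, multiplied by a power of [t] to remove negative
    exponents, the coefficient of each power of [t] is a linear relation
    between images of distinct elements of [D]. *)
Lemma generic_on_adjoin_transcendental : exists chi' : L -> K',
  generic_on (adjoin H h) chi' /\ forall x, H x -> chi' x = phi (chi x).
Proof.
have [HH _ _ _ virt] := gen; have [H1 _ HM HV] := HH.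
have [_ pchi1 pchiM _ _] := generic_on_rmorph phi gen.
have [chi' [chi'M chi'inj chi'E]] :=
  character_adjoin HH pchi1 pchiM h_neq0 t_neq0 transcendental_zpow.
have chi'H x : H x -> chi' x = phi (chi x).
  by move=> Hx; have := chi'E 0 x Hx; rewrite !expr0z !mul1r.
exists chi'; split=> //; split=> // [||s sH].
- exact: adjoin_subgroup.
- by rewrite chi'H.
have /choice [ex /choice [co ecP]] : forall x, exists (i : int) (a : L), x \in s ->
    H a /\ x = h ^ i * a.
  move=> x; have [/sH [i [a xE]]|_] := boolP (x \in s); first by exists i, a.
  by exists 0, 0.
have [_ /mapP [x /ecP [Hx _] -> //]|N [D [N0 DD DH liD sD]]] := virt (map co s).
exists N, (adjoin D h); split=> //; first exact: adjoin_subgroup.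
- by move=> _ [i [a [/DH Ha ->]]]; exists i, a.
- move=> r c ur rD sum0.
  have /choice [e /choice [d edP]] : forall x, exists (i : int) (a : L), x \in r ->
      D a /\ x = h ^ i * a.
    move=> x; have [/rD [i [a xE]]|_] := boolP (x \in r); first by exists i, a.
    by exists 0, 0.
  have [M MP] : exists M : nat, forall x, x \in r -> exists n : nat,
      e x + M%:Z = n%:Z.
    elim: r {ur rD sum0 edP} => [|x r [M MP]]; first by exists 0%N.
    exists (M + `|e x|)%N => y; rewrite inE => /predU1P [->|/MP [n E]].
      case: (e x) => n; first by exists (n + (M + n))%N.
      exists M; rewrite NegzE PoszD addrCA /= addNr addr0 //.
    by exists (n + `|e x|)%N; rewrite !PoszD addrA E.
  have /choice [n nP] : forall x, exists n : nat, x \in r -> e x + M%:Z = n%:Z.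
    by move=> x; have [/MP [k E]|_] := boolP (x \in r); [exists k|exists 0%N].
  have rE x : x \in r -> t ^+ M * chi' x = tau ((chi (d x))%:P * 'X^(n x)).
    move=> xr; have [/DH Hd {1}->] := edP x xr; rewrite chi'E // mulrA.
    rewrite -[t ^+ M]/(t ^ M%:Z) -expfzDr // addrC nP // mulrC rmorphM; congr (_ * _).
    by rewrite rmorphXn.
  pose P : {poly K} := \sum_(x <- r) (c x)%:~R * ((chi (d x))%:P * 'X^(n x)).
  have P0 : P = 0.
    apply: tau_inj; rewrite rmorph0 /P rmorph_sum.
    transitivity (t ^+ M * \sum_(x <- r) (c x)%:~R * chi' x);
        last by rewrite sum0 mulr0.
    rewrite mulr_sumr; apply: eq_big_seq => x xr.
    by rewrite rmorphM rmorph_int -rE // mulrCA.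
  move=> x xr; pose r' := [seq y <- r | n y == n x].
  apply: (lin_independent_on_family (s := r') (e := d) (c := c) liD).
  + exact: filter_uniq.
  + move=> y z; rewrite !mem_filter => /andP [/eqP ny yr] /andP [/eqP nz zr] E.
    have [_ ->] := edP y yr; have [_ ->] := edP z zr; rewrite E; congr (_ ^ _ * _).
    by apply: (addIr M%:Z); rewrite !nP // ny nz.
  + by move=> y; rewrite mem_filter => /andP [_ /edP []].
  + have := congr1 (fun p : {poly K} => p`_(n x)) P0; rewrite coef0 /P coef_sum => E.
    rewrite -[RHS]E big_filter [LHS]big_mkcond; apply: eq_bigr => y _ /=.
    rewrite -(rmorph_int (polyC : {rmorphism K -> {poly K}})) mulrA -polyCM coefCM.
    by rewrite coefXn eq_sym; case: eqP; rewrite ?mulr1 ?mulr0.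
  + by rewrite mem_filter eqxx.
- move=> x xs; have [Hx {1}->] := ecP x xs; rewrite exprMn.
  exists (ex x * N%:Z), (co x ^+ N); split; first by apply/sD/map_f.
  by rewrite -exprz_exp.
Qed.
End TranscendentalAdjunction.

(** * Extension to the whole multiplicative group *)

Lemma tofrac_inj (R : idomainType) : injective (@tofrac R).
Proof. by move=> a b /eqP; rewrite tofrac_eq => /eqP. Qed.

Lemma fraction_closure_exists (R : idomainType) :
  exists (E : closedFieldType) (iota : {rmorphism R -> E}), injective iota.
Proof.
have [E [iota]] := algebraic_closure_exists {fraction R}.
exists E, (iota \o @tofrac R : {rmorphism R -> E}).
by apply: inj_comp (@tofrac_inj R); apply: fmorph_inj.
Qed.

Lemma pchar_rmorph_inj (R S : idomainType) (f : {rmorphism R -> S}) :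
  injective f -> [pchar S] =i [pchar R].
Proof.
move=> f_inj q; rewrite !inE; congr (_ && _).
by rewrite -(rmorph_nat f) -(rmorph0 f) (inj_eq f_inj).
Qed.

(** Only finitely many elements are adjoined here, so the target grows by
    finitely many closures; it depends on [s]. *)
Lemma generic_on_finite_extension (L : fieldType) (K : closedFieldType)
    (H : L -> Prop) (chi : L -> K) (s : seq L) :
  [pchar K] =i pred0 -> generic_on H chi ->
  exists (K' : closedFieldType) (phi : {rmorphism K -> K'}) (H' : L -> Prop)
      (chi' : L -> K'),
    [/\ generic_on H' chi', forall x, H x -> H' x,
        forall x, x \in s -> x != 0 -> H' x & forall x, H x -> chi' x = phi (chi x)].
Proof.
move=> charK gen; elim: s => [|h s [K1 [phi [H1 [chi1 [gen1 HH1 sH1 chi1E]]]]]].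
  by exists K, idfun, H, chi.
have [h0|h0] := eqVneq h 0.
  exists K1, phi, H1, chi1; split=> // x; rewrite inE h0 => /predU1P [->|/sH1 //].
  by rewrite eqxx.
have [[m [m0 Hm]]|Hfree] := pselect (exists m, (0 < m)%N /\ H1 (h ^+ m)).
  have charK1 : [pchar K1] =i pred0.
    by move=> q; rewrite (pchar_rmorph_inj (fmorph_inj phi)).
  have [H2 [chi2 [gen2 H2h H12 chi2E]]] :=
      generic_on_adjoin_root charK1 m0 gen1 h0 Hm.
  exists K1, phi, H2, chi2; split=> // x.
  - by move/HH1/H12.
  - by rewrite inE => /predU1P [-> //|xs x0]; apply/H12/sH1.
  - by move=> Hx; rewrite chi2E ?chi1E //; apply: HH1.
have [K2 [tau tau_inj]] := fraction_closure_exists {poly K1}.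
have [|chi2 [gen2 chi2E]] := generic_on_adjoin_transcendental tau_inj gen1 h0.
  by move=> m m0 Hm; apply: Hfree; exists m.
have [HH _ _ _ _] := gen1.
exists K2, (tau \o polyC \o phi : {rmorphism K -> K2}), (adjoin H1 h), chi2;
    split=> // x.
- by move/HH1; apply: sub_adjoin.
- rewrite inE => /predU1P [-> _|xs x0]; first exact: adjoin_gen.
  by apply/sub_adjoin/sH1.
- by move=> Hx; rewrite chi2E ?chi1E //; apply: HH1.
Qed.

Lemma mult_independent_neq0 (F : idomainType) (n : nat) (alpha : 'I_n -> F) i :
  mult_independent alpha -> alpha i != 0.
Proof.
move=> indep; apply/eqP => ai0; apply: indep; exists U_(i)%MM, (U_(i) *+ 2)%MM; split.
  by move/mnmP/(_ i); rewrite mulmnE mnm1E eqxx.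
have -> : \prod_(j < n) alpha j ^+ U_(i)%MM j = 0.
  by rewrite (bigD1 i) //= mnm1E eqxx ai0 expr1 mul0r.
by rewrite (bigD1 i) //= mulmnE mnm1E eqxx ai0 expr0n mul0r.
Qed.

(** The finite extensions agree on [H] but not elsewhere. Their ultraproduct
    along inclusion of finite sets needs no agreement: each instance of
    multiplicativity, of injectivity or of algebraic independence concerns
    finitely many elements of [L], and so holds eventually. *)
Lemma generic_on_full_extension (L : fieldType) (K : closedFieldType)
    (H : L -> Prop) (chi : L -> K) :
  [pchar K] =i pred0 -> generic_on H chi ->
  exists (K' : fieldType) (phi : {rmorphism K -> K'}) (chi' : L -> K'),
    [/\ is_character chi', injective chi',
        forall (n : nat) (alpha : 'I_n -> L), mult_independent alpha ->
          int_independent (chi' \o alpha)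
      & forall x, H x -> chi' x = phi (chi x)].
Proof.
move=> charK gen.
have /choice [E EP] : forall s : seq L, exists K' : closedFieldType,
    exists (phi : {rmorphism K -> K'}) (H' : L -> Prop) (chi' : L -> K'),
    [/\ generic_on H' chi', forall x, H x -> H' x,
        forall x, x \in s -> x != 0 -> H' x & forall x, H x -> chi' x = phi (chi x)].
  by move=> s; apply: generic_on_finite_extension.
pose phi s := projT1 (cid (EP s)).
have EP1 s := projT2 (cid (EP s)); rewrite -/(phi _) in EP1.
pose D s := projT1 (cid (EP1 s)).
have EP2 s := projT2 (cid (EP1 s)); rewrite -/(D _) in EP2.
pose c s := projT1 (cid (EP2 s)).
have EP3 s := projT2 (cid (EP2 s)); rewrite -/(c _) in EP3.
pose le (s t : seq L) := {subset s <= t}.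
have [s x //|s t|U [pi [pi0 pi_neq0]]] :=
    @ultraproduct_exists (seq L) [::] le (fun s => E s).
  exists (s ++ t) => u su; split=> x xs; apply: su; first by rewrite mem_cat xs.
  by rewrite mem_cat xs orbT.
have pi_eq (x y : dprod_of (fun s => E s) [::]) :
    (exists s, forall t, le s t -> x t = y t) -> pi x = pi y.
  move=> [s xy]; apply/eqP; rewrite -subr_eq0 -rmorphB; apply/eqP/pi0.
  by exists s => t /xy E1; rewrite -[LHS]/(x t - y t) E1 subrr.
pose X (x : L) : dprod_of (fun s => E s) [::] := fun s => if x == 0 then 0 else c s x.
have cM s x y : x \in s -> y \in s -> X (x * y) s = X x s * X y s.
  have [[_ _ cM _ _] _ sD _] := EP3 s; rewrite /X mulf_eq0 => xs ys.
  have [_|x0] := eqVneq x 0; first by rewrite mul0r.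
  have [_|y0] := eqVneq y 0; first by rewrite mulr0.
  by apply: cM; apply: sD.
have c_inj s x y : x \in s -> y \in s -> X x s = X y s -> x = y.
  have [[DD c1 cM' ci _] _ sD _] := EP3 s; rewrite /X => xs ys.
  have [->|x0] := eqVneq x 0; have [->|y0] := eqVneq y 0 => // E1.
  - by case/eqP: (chi_neq0 DD c1 cM' (sD y ys y0)).
  - by case/eqP: (chi_neq0 DD c1 cM' (sD x xs x0)).
  - by apply: ci => //; apply: sD.
exists U, (pi \o dprod_diag [::] phi : {rmorphism K -> U}), (fun x => pi (X x)).
split.
- split=> [x y||].
  + rewrite -rmorphM; apply: pi_eq; exists [:: x; y] => s le_s.
    by apply: cM; apply: le_s; rewrite !inE eqxx ?orbT.
  + by apply: pi0; exists [::] => s _; rewrite /X eqxx.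
  + rewrite -(rmorph1 pi); apply: pi_eq; exists [::] => s _.
    by have [[_ c1 _ _ _] _ _ _] := EP3 s; rewrite /X oner_eq0; apply: c1.
- move=> x y /eqP; rewrite -subr_eq0 -rmorphB => /eqP E0.
  have [//|/eqP xy] := eqVneq x y; case: (pi_neq0 _ _ E0).
  exists [:: x; y] => s le_s; move=> /eqP; rewrite -[X in X == 0]/(X x s - X y s).
  rewrite subr_eq0 => /eqP /c_inj E1; apply: xy.
  by apply: E1; apply: le_s; rewrite !inE eqxx ?orbT.
- move=> n alpha indep P; rewrite -(mmap_intr_rmorph pi (X \o alpha)) => E0.
  have [//|/eqP P0] := eqVneq P 0; case: (pi_neq0 _ _ E0).
  exists (codom alpha) => s le_s E1.
  have {E1} : dprod_proj s (mmap intr (X \o alpha) P) = 0 by [].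
  rewrite mmap_intr_rmorph.
  rewrite (@eq_mmap_intr _ _ _ (c s \o alpha)); last first.
    by move=> i; rewrite /= /dprod_proj /X (negPf (mult_independent_neq0 i indep)).
  have [gen' _ sD _] := EP3 s; move=> E1; apply: P0.
  apply: (int_independent_of_generic_on gen' _ indep E1) => i.
  by apply: sD; [apply/le_s/codom_f|apply: mult_independent_neq0].
- move=> x Hx /=; apply: pi_eq; exists [::] => s _.
  have [HH _ _ _ _] := gen; rewrite /X (negPf (subgroup_neq0 HH Hx)).
  by have [_ _ _ cE] := EP3 s; apply: cE.
Qed.

(** * Independence over the prime field *)

Lemma intr_eq0_pchar0 (R : idomainType) (z : int) :
  [pchar R] =i pred0 -> z%:~R = 0 :> R -> z = 0.
Proof.
move=> /pcharf0P charR z0; apply/eqP; rewrite -absz_eq0 -charR.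
case: z z0 => k => [/eqP //|].
by rewrite NegzE rmorphN => /eqP; rewrite oppr_eq0.
Qed.

Section PrimeField.
Variable E : fieldType.

Lemma prime_field_int (z : int) : @prime_field E z%:~R.
Proof.
move=> S [S1 SB SV].
have S0 : 0 \in S by rewrite -(subrr 1) SB.
have SN x : x \in S -> - x \in S by move=> Sx; rewrite -sub0r SB.
have Sn n : n%:R \in S.
  elim: n => [//|n IH].
  have -> : n.+1%:R = n%:R - (- 1) :> E by rewrite opprK natr1.
  by apply: SB => //; apply: SN.
by case: z => n; [exact: Sn|rewrite NegzE rmorphN; exact: SN _ (Sn n.+1)].
Qed.

(** The quotients of images of integers form a subfield. *)
Lemma prime_field_fraction (x : E) : prime_field x ->
  exists a b : int, b%:~R != 0 :> E /\ x = a%:~R / b%:~R.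
Proof.
pose S : {pred E} := fun x => `[< exists a b : int,
    b%:~R != 0 :> E /\ x = a%:~R / b%:~R >].
move=> /(_ S) H; apply/asboolP/H; split.
- by apply/asboolP; exists 1, 1; rewrite oner_eq0 divr1.
- move=> y z /asboolP [a [b [b0 ->]]] /asboolP [c [d [d0 ->]]]; apply/asboolP.
  exists (a * d - c * b), (b * d); rewrite rmorphM mulf_neq0 //; split=> //.
  by rewrite -mulNr addf_div // rmorphB !rmorphM mulNr.
- move=> y z /asboolP [a [b [b0 ->]]] /asboolP [c [d [d0 ->]]]; apply/asboolP.
  have [c0|c0] := eqVneq (c%:~R : E) 0.
    by exists 0, 1; rewrite oner_eq0 c0 mul0r invr0 mulr0 mul0r.
  exists (a * d), (b * c); rewrite rmorphM mulf_neq0 //; split=> //.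
  by rewrite invf_div mulf_div !rmorphM.
Qed.

Lemma alg_independent_over_prime_field (n : nat) (v : 'I_n -> E) :
  [pchar E] =i pred0 ->
  alg_independent_over (@prime_field E) v <-> int_independent v.
Proof.
move=> charE; split=> [indep P Pv|indep P Pk Pv].
  have Q0 : map_mpoly intr P = 0 :> {mpoly E[n]}.
    apply: indep => [m|]; first by rewrite mcoeff_map_mpoly; apply: prime_field_int.
    rewrite -[RHS]Pv /map_mpoly [in LHS]/mmap rmorph_sum; apply: eq_bigr => m _.
    by rewrite rmorphM /= mevalC mmap1_id mevalX.
  apply/mpolyP => m; rewrite mcoeff0; apply: (intr_eq0_pchar0 charE).
  by rewrite -(mcoeff_map_mpoly intr) Q0 mcoeff0.
have [d [d0 dP]] : exists d : int, d%:~R != 0 :> E /\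
    forall m, m \in msupp P -> exists z : int, d%:~R * P@_m = z%:~R.
  elim: (msupp P : seq _) => [|m s [d [d0 dP]]]; first by exists 1; rewrite oner_eq0.
  have [a [b [b0 mE]]] := prime_field_fraction (Pk m).
  exists (d * b); rewrite rmorphM mulf_neq0 //; split=> // m'.
  rewrite inE => /predU1P [->|/dP [z zE]].
    by exists (d * a); rewrite mE -mulrA [_ * (_ / _)]mulrC divfK // rmorphM.
  by exists (b * z); rewrite mulrAC zE mulrC rmorphM.
have /choice [z zP] : forall m, exists z : int, m \in msupp P -> d%:~R * P@_m = z%:~R.
  by move=> m; have [/dP [z zE]|_] := boolP (m \in msupp P); [exists z|exists 0].
pose Q : {mpoly int[n]} := \sum_(m <- msupp P) z m *: 'X_[m].
have Q0 : Q = 0.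
  apply: indep; rewrite /Q raddf_sum /=.
  transitivity (d%:~R * P.@[v]); last by rewrite Pv mulr0.
  rewrite mevalE mulr_sumr; apply: eq_big_seq => m mP.
  by rewrite mmapZ mmapX mulrA zP.
apply/mpolyP => m; rewrite mcoeff0.
have [mP|/memN_msupp_eq0 //] := boolP (m \in msupp P).
have /(congr1 (mcoeff m)) := Q0; rewrite mcoeff0 /Q raddf_sum /= (bigD1_seq m) //=.
rewrite big1 => [|m' m'm]; last by rewrite mcoeffZ mcoeffX (negPf m'm) mulr0.
rewrite addr0 mcoeffZ mcoeffX eqxx mulr1 => zm0.
by move: (zP m mP); rewrite zm0 => /eqP; rewrite mulf_eq0 (negPf d0) => /eqP.
Qed.
End PrimeField.

Lemma int_independent_rmorph_inj (R S : comNzRingType) (f : {rmorphism R -> S})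
    (n : nat) (v : 'I_n -> R) :
  injective f -> int_independent v -> int_independent (f \o v).
Proof.
move=> f_inj indep P; rewrite -mmap_intr_rmorph => fP0; apply: indep.
by apply: f_inj; rewrite rmorph0.
Qed.

Lemma int_independent_of_rmorph (R S : comNzRingType) (f : {rmorphism R -> S})
    (n : nat) (v : 'I_n -> R) : int_independent (f \o v) -> int_independent v.
Proof. by move=> indep P vP0; apply: indep;
    rewrite -mmap_intr_rmorph vP0 rmorph0. Qed.

(** The empty family, which the definition of a generic character leaves out;
    it occurs as the multiplicative basis of a family of roots of unity. *)
Lemma int_independent0 (R : idomainType) (v : 'I_0 -> R) :
  [pchar R] =i pred0 -> int_independent v.
Proof.
move=> charR P.
have -> : P = (P@_0)%:MP.
  apply/mpolyP => m; have -> : m = 0%MM by apply/mnmP => -[].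
  by rewrite mcoeffC eqxx mulr1.
rewrite mmapC => P0; suff -> : P@_0 = 0 by rewrite mpolyC0.
exact: intr_eq0_pchar0 P0.
Qed.

Lemma genericP (F K : idomainType) (chi : F -> K) : [pchar K] =i pred0 ->
  generic chi <->
  injective chi /\ forall (n : nat) (alpha : 'I_n -> F),
    mult_independent alpha -> int_independent (chi \o alpha).
Proof.
move=> charK; have charFr : [pchar {fraction K}] =i pred0.
  by move=> q; rewrite (pchar_rmorph_inj (@tofrac_inj K)).
split=> -[chi_inj indep]; split=> // n alpha.
  case: n alpha => [|n] alpha ind; first exact: int_independent0.
  apply: (int_independent_of_rmorph (f := @tofrac K)).
  by apply/alg_independent_over_prime_field => //; apply: indep.
move=> n0 ind; apply/alg_independent_over_prime_field => //.
exact/(int_independent_rmorph_inj (f := @tofrac K) (@tofrac_inj K))/indep.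
Qed.

(** * Substructures and models *)

Lemma has_char_rmorph_inj (R S : idomainType) (f : {rmorphism R -> S}) (p : nat) :
  injective f -> has_char S p <-> has_char R p.
Proof.
move=> /pchar_rmorph_inj E; rewrite /has_char; case: eqP => _; last by rewrite E.
by split=> H q; rewrite -H E.
Qed.

(** An embedding preserves multiplicative independence and reflects algebraic
    independence. *)
Lemma generic_substructure (F K F' K' : idomainType) (chi : F -> K)
    (chi' : F' -> K') :
  [pchar K] =i pred0 -> [pchar K'] =i pred0 ->
  generic chi' -> is_substructure chi chi' -> generic chi.
Proof.
move=> charK charK' /(genericP _ charK') [chi'_inj indep] [f [g [f_inj g_inj fg]]].
apply/(genericP _ charK); split=> [a b E|n alpha ind].
  by apply/f_inj/chi'_inj; rewrite -!fg E.
apply: (int_independent_of_rmorph (f := g)).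
have ind' : mult_independent (f \o alpha).
  move=> [k [l [kl E]]]; apply: ind; exists k, l; split=> //; apply: f_inj.
  by rewrite !rmorph_prod; under eq_bigr do rewrite rmorphXn;
     under [RHS]eq_bigr do rewrite rmorphXn.
move=> P P0; apply: (indep n _ ind'); rewrite -[RHS]P0.
by apply: eq_mmap_intr => i /=; rewrite fg.
Qed.

Lemma generic_model_exists (F K : idomainType) (p : nat) (chi : F -> K) :
  has_char K 0 -> has_char F p -> is_character chi -> generic chi ->
  exists (F' K' : closedFieldType) (chi' : F' -> K'),
    is_model_ACFC p chi' /\ is_substructure chi chi'.
Proof.
move=> charK charF [chiM chi0 chi1] /(genericP _ charK) [chi_inj indep].
have [L [f f_inj]] := fraction_closure_exists F.
have [K0 [g g_inj]] := fraction_closure_exists K.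
have charK0 : [pchar K0] =i pred0 by apply/(has_char_rmorph_inj 0 g_inj).
have [||||| chi0' [gen chi0'E]] := @generic_on_fractions F L K0 f (g \o chi) f_inj.
- exact: inj_comp.
- by move=> a b; rewrite /= chiM rmorphM.
- by rewrite /= chi0 rmorph0.
- by rewrite /= chi1 rmorph1.
- move=> n alpha ind; apply: (int_independent_rmorph_inj (v := chi \o alpha) g_inj).
  exact: indep.
have [K1 [phi [chi1' [[chi1'M chi1'0 chi1'1] chi1'_inj indep' chi1'E]]]] :=
  generic_on_full_extension charK0 gen.
have [K2 [iota]] := algebraic_closure_exists K1.
have charK2 : [pchar K2] =i pred0.
  by apply/(has_char_rmorph_inj 0 (fmorph_inj (iota \o phi))).
exists L, K2, (iota \o chi1'); split; [split=> //|].
- exact/(has_char_rmorph_inj p f_inj).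
- split=> [a b||] /=; first by rewrite chi1'M rmorphM.
    by rewrite chi1'0 rmorph0.
  by rewrite chi1'1 rmorph1.
- apply/(genericP _ charK2); split; first exact: inj_comp (@fmorph_inj _ _ iota) _.
  move=> n alpha ind; apply: (int_independent_rmorph_inj (v := chi1' \o alpha)).
    exact: fmorph_inj.
  exact: indep'.
exists f, (iota \o phi \o g : {rmorphism K -> K2}); split=> //.
  by apply: inj_comp g_inj; apply: fmorph_inj.
move=> a /=; have [->|a0] := eqVneq a 0.
  by rewrite chi0 !rmorph0 chi1'0 rmorph0.
rewrite chi1'E ?chi0'E //; exists a, 1; split=> //; first exact: oner_neq0.
by rewrite rmorph1 divr1.
Qed.

Theorem proposition1p5 (p : nat) (hp : prime p \/ p = 0%N)
    (F K : idomainType) (hK : has_char K 0)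
    (chi : F -> K) (hchi : is_character chi) :
  (exists (F' K' : closedFieldType) (chi' : F' -> K'),
      is_model_ACFC p chi' /\ is_substructure chi chi')
  <-> (generic chi /\ has_char F p).
Proof.
split=> [[F' [K' [chi' [[charF' charK' _ gen'] sub]]]]|[gen charF]].
  split; first exact: generic_substructure gen' sub.
  by have [f [_ [f_inj _ _]]] := sub; apply/(has_char_rmorph_inj p f_inj).
exact: generic_model_exists.
Qed.
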